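(* Let $(X,d)$ be a metric space, let $G\subsetneq X$ be a domain, let $\mu\in(0,1)$ and $x,y\in G$. If $d(x,y)>\mu\max\{\delta_G(x),\delta_G(y)\}$ and $\gamma\subset G$ is a rectifiable curve joining $x$ and $y$, then there exist a sequence of points $x=z_1,z_2,\dots,z_{k+1}=y$ on $\gamma$ and a finite sequence of balls $\{\overline{B}_i\}_{i=1}^k$ in $G$ such that: (1) for each $i\in\{1,\dots,k\}$, $\overline{B}_i=\overline{B}(z_i,r_i)$ with $r_i=\mu\,\delta_G(z_i)$, and, for $i\ge2$, $z_i\in\gamma[z_{i-1},y]$ but $z_i\notin B_{i-1}$, where $B_{i-1}=B(z_{i-1},r_{i-1})$; (2) $z_{k+1}=y\in\overline{B}_k$; (3) for any pair $\{i,j\}\subset\{1,\dots,k\}$ with $|j-i|>1$, $\overline{B}_i\cap\overline{B}_j=\emptyset$ provided that $k\ge3$; (4) for each $i\in\{1,\dots,k-1\}$, $\overline{B}_i\cap\overline{B}_{i+1}\ne\emptyset$.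
   Context: A domain is a nonempty open connected set. For $G\subsetneq X$ put $\delta_G(z)=\inf\{d(z,y): y\in X\setminus G\}$. $B(x,r)=\{y\in X: d(x,y)<r\}$ and $\overline{B}(x,r)=\{y\in X: d(x,y)\le r\}$. A curve is a continuous map $\gamma:[a,b]\to X$, identified with its image when convenient; it joins $x$ and $y$ if $\gamma(a)=x$, $\gamma(b)=y$; it is rectifiable if its length is finite. For points $u,v$ on $\gamma$, $\gamma[u,v]$ is the subcurve of $\gamma$ with endpoints $u,v$ (points on $\gamma$ are understood together with their parameter values). *)

(* Defs.v *)
From HB Require Import structures.
From mathcomp Require Import all_boot all_order all_algebra.
From mathcomp Require Import all_classical all_reals all_analysis.

Set Implicit Arguments.
Unset Strict Implicit.
Unset Printing Implicit Defensive.

Import Order.TTheory GRing.Theory Num.Theory.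
Import numFieldTopology.Exports.

Local Open Scope classical_set_scope.
Local Open Scope ring_scope.

Definition domain (T : topologicalType) (G : set T) : Prop :=
  [/\ G !=set0, open G & connected G].

(* The infimum is taken in the reals; it is the genuine distance to the
   complement only when G is a proper subset ([inf set0 = 0]). *)
Definition bdist (R : realType) (X : metricType R) (G : set X) (z : X) : R :=
  inf [set mdist z w | w in ~` G].

(* Not the library's [closed_ball], which is the closure of the open ball and
   may be strictly smaller in a general metric space. *)
Definition cball (R : realType) (X : metricType R) (x : X) (r : R) : set X :=
  [set y | mdist x y <= r].

(* A curve [a, b] -> X is a total map R -> X of which only the restriction to
   [a, b] matters. *)
Definition curve (R : realType) (X : metricType R) (a b : R) (g : R -> X) :
    Prop :=
  a <= b /\ {within `[a, b], continuous g}.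

(* [itv_partition a b s] says that a :: s is strictly increasing and ends
   at b. *)
Definition curve_length (R : realType) (X : metricType R) (a b : R)
    (g : R -> X) : \bar R :=
  ereal_sup [set (\sum_(0 <= n < size s)
      mdist (g (nth b (a :: s) n)) (g (nth b (a :: s) n.+1)))%:E
    | s in itv_partition a b].

Definition rectifiable (R : realType) (X : metricType R) (a b : R)
    (g : R -> X) : Prop :=
  (curve_length a b g < +oo)%E.

(* Main.v *)
Require Import Defs.
From HB Require Import structures.
From mathcomp Require Import all_boot all_order all_algebra.
From mathcomp Require Import all_classical all_reals all_analysis.
From mathcomp Require Import lra zify.

(* The chain is greedy: from the parameter [t], let [s] be the supremum of the
   later parameters whose ball meets the ball at [t].  In a general metric space
   [s] need not be attained, so the next parameter [t'] is a meeting one, not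
   before the last visit to the ball at [t], and so close to [s] that the point
   of parameter [s] lies in the open ball at [t'].  If that ball does not contain
   the endpoint yet, its own last visit comes strictly after [s], hence the next
   step jumps past [s] and no later ball meets the ball at [t].  The parameters
   cannot go on forever: they would converge to some [L], and the steps, which
   are at least as long as the radii, would shrink to 0 although the radii tend
   to the positive radius at [L]. *)

Set Implicit Arguments.
Unset Strict Implicit.
Unset Printing Implicit Defensive.

Import Order.TTheory GRing.Theory Num.Theory.
Import numFieldTopology.Exports.

Local Open Scope classical_set_scope.
Local Open Scope ring_scope.

(** * Distance to the complement *)

Section Bdist.
Variables (R : realType) (X : metricType R).
Implicit Types (G : set X) (z w : X).

Lemma bdist_le_mdist G z w : ~ G w -> bdist G z <= mdist z w.
Proof.
move=> nGw; apply: ge_inf; last by exists w.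
by exists 0 => _ [v _ <-]; exact: mdist_ge0.
Qed.

Lemma bdist_lipschitz G z w : G `<` [set: X] ->
  bdist G z <= bdist G w + mdist z w.
Proof.
move=> GT; rewrite -lerBlDr; apply: lb_le_inf.
  by have [_ /nonsubset[v [_ nGv]]] := GT; exists (mdist w v); exists v.
move=> _ [v nGv <-].
have := bdist_le_mdist z nGv; have := metric_triangle z w v; lra.
Qed.

Lemma bdist_gt0 G z : G `<` [set: X] -> open G -> G z -> 0 < bdist G z.
Proof.
move=> GT oG Gz.
have /nbhs_ballP[e /= e0 eG] : nbhs z G by exact: open_nbhs_nbhs.
apply: (lt_le_trans e0); apply: lb_le_inf.
  by have [_ /nonsubset[v [_ nGv]]] := GT; exists (mdist z v); exists v.
move=> _ [v nGv <-]; rewrite leNgt; apply/negP => zv.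
by apply: nGv; apply: eG; rewrite ballEmdist.
Qed.

Lemma cball_bdist_sub G z (mu : R) : G `<` [set: X] -> open G -> G z ->
  mu < 1 -> cball z (mu * bdist G z) `<=` G.
Proof.
move=> GT oG Gz mu1 v; rewrite /cball /= => zv; apply: contrapT => nGv.
have d0 := bdist_gt0 GT oG Gz; have dzv := bdist_le_mdist z nGv; nra.
Qed.

End Bdist.

(** * Greedy chains of balls along a curve, for a 1-Lipschitz radius *)

Lemma curve_mdist_lt (R : realType) (X : metricType R) (a b : R) (g : R -> X)
    (s e : R) : curve a b g -> a <= s <= b -> 0 < e ->
  exists2 d, 0 < d &
    forall u, a <= u <= b -> `|u - s| < d -> mdist (g s) (g u) < e.
Proof.
move=> [_ /subspace_continuousP/(_ s)] + sab e0.
rewrite /= in_itv => /(_ sab)/metricType_numDomainType.cvgr_dist_lt/(_ _ e0)/nbhs_ballP[d /= d0 dP].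
exists d => // u uab us; apply: dP => /=; last by rewrite in_itv.
by rewrite /ball /= distrC.
Qed.

Section BallChain.
Variables (R : realType) (X : metricType R) (a b : R) (g : R -> X) (r : X -> R).
Hypothesis g_curve : curve a b g.
Hypothesis r_lip : forall z w, r z <= r w + mdist z w.
Hypothesis r_gt0 : forall s, a <= s <= b -> 0 < r (g s).

Let B s := cball (g s) (r (g s)).
Let meets s u := B s `&` B u !=set0.

(** Since [g b] is outside the ball, [s < b], so continuity leaves room to move on from [s] inside
    it. *)
Lemma curve_stays_in_ball t s : a <= s -> s <= b ->
  mdist (g t) (g s) < r (g t) -> r (g t) < mdist (g t) (g b) ->
  exists2 u, s < u <= b & B t (g u).
Proof.
move=> sa sb ts tb.
have s_b : s < b.
  by rewrite lt_neqAle sb andbT; apply/eqP => e; move: ts; rewrite e; lra.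
have [||d d0 dP] :=
  @curve_mdist_lt _ _ _ _ _ s (r (g t) - mdist (g t) (g s)) g_curve.
- lra.
- lra.
pose u := s + Num.min (b - s) (d / 2).
have [u1 u2 u3] : [/\ s < u, u <= b & u - s < d].
  by rewrite /u; case: (leP (b - s) (d / 2)) => h; split; lra.
exists u; first lra.
have := dP u; rewrite ger0_norm; last lra.
move=> /(_ _ u3) h.
have {}h : mdist (g s) (g u) < r (g t) - mdist (g t) (g s) by apply: h; lra.
rewrite /B /cball /=; have := metric_triangle (g t) (g s) (g u); lra.
Qed.

(** In the last clause an upper bound [s] of the meeting parameters is enough; what counts is that
    [g s] lies strictly inside the ball at [t']. *)
Definition greedy_step t t' : Prop :=
  [/\ t <= t' <= b, meets t t',
      forall u, u <= b -> B t (g u) -> u <= t' &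
      exists2 s, t <= s <= b & mdist (g t') (g s) < r (g t') /\
                 forall u, t <= u <= b -> meets t u -> u <= s].

Lemma mem_cball s : a <= s <= b -> B s (g s).
Proof. by move=> sab; rewrite /B /cball /= mdistxx ltW// r_gt0. Qed.

Lemma greedy_step_ex t : a <= t <= b -> exists t', greedy_step t t'.
Proof.
move=> tab.
pose E := [set u | t <= u <= b /\ B t (g u)].
pose S := [set u | t <= u <= b /\ meets t u].
have Et : E t by split; [lra|exact: mem_cball].
have ES : E `<=` S.
  move=> u [utb Bu]; split=> //; exists (g u); split => //.
  by apply: mem_cball; lra.
have hE : has_sup E by split; [exists t | exists b => u [/andP[]]].
have hS : has_sup S.
  by split; [exists t; exact: ES | exists b => u [/andP[]]].
have leE u : E u -> u <= sup E by apply: ub_le_sup; case: hE.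
have leS u : S u -> u <= sup S by apply: ub_le_sup; case: hS.
have Eb : sup E <= b by apply: ge_sup; [case: hE | move=> u [/andP[]]].
have Sb : sup S <= b by apply: ge_sup; [case: hS | move=> u [/andP[]]].
have tE := leE _ Et.
(* The last visit is attained, because the ball is closed and the curve continuous. *)
have E_sup : E (sup E).
  split; first lra.
  rewrite /B /cball /=; apply/ler_addgt0Pr => e e0.
  have [|d d0 dP] := @curve_mdist_lt _ _ _ _ _ (sup E) e g_curve _ e0.
    lra.
  have [u Eu du] := sup_adherent d0 hE.
  have uE := leE _ Eu; have [utb Btu] := Eu.
  have : mdist (g (sup E)) (g u) < e.
    by apply: dP; [lra | rewrite ler0_norm; lra].
  rewrite metric_sym; move: Btu; rewrite /B /cball /=.
  have := metric_triangle (g t) (g u) (g (sup E)); lra.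
have ES_sup := leS _ (ES _ E_sup).
have rS : 0 < r (g (sup S)) by apply: r_gt0; lra.
(* Within half the radius at [sup S], the Lipschitz bound keeps the radius at [t'] above half, so
   the ball at [t'] contains [g (sup S)]. *)
have [||d d0 dP] :=
  @curve_mdist_lt _ _ _ _ _ (sup S) (r (g (sup S)) / 2) g_curve.
- lra.
- lra.
have [t' [St' Et' dt']] : exists t', [/\ S t', sup E <= t' & sup S - d < t'].
  have [u Su du] := sup_adherent d0 hS.
  have [uE|uE] := leP u (sup E).
    exists (sup E); split => //; [exact: ES | lra].
  by exists u; split => //; lra.
have t'S := leS _ St'; have [t'b tt'] := St'.
exists t'; split => //.
- move=> u ub Btu; apply: le_trans Et'.
  by have [ut|ut] := leP t u; [apply: leE; split => //; lra | lra].
- exists (sup S); first lra.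
  split; last by move=> u utb tu; apply: leS.
  have : mdist (g (sup S)) (g t') < r (g (sup S)) / 2.
    by apply: dP; [lra | rewrite ler0_norm; lra].
  have := r_lip (g (sup S)) (g t').
  rewrite (metric_sym (g t')); lra.
Qed.

(** If [g t'] were strictly inside the ball at [t], the curve would visit that ball after [t']. *)
Lemma greedy_step_far t t' : a <= t -> greedy_step t t' ->
  r (g t) < mdist (g t) (g b) -> r (g t) <= mdist (g t) (g t').
Proof.
move=> a_le_t [tt' _ h _] tb; rewrite leNgt; apply/negP => near.
have [||u ut' Bu] := curve_stays_in_ball _ _ near tb; [lra|lra|].
have := h u _ Bu; lra.
Qed.

(** The curve is still in the ball at [t'] just after [s], so [t''] lies beyond [s], which bounds
    all parameters meeting the ball at [t]. *)
Lemma greedy_step2_disjoint t t' t'' u : a <= t ->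
  greedy_step t t' -> greedy_step t' t'' -> r (g t') < mdist (g t') (g b) ->
  t'' <= u <= b -> B t `&` B u = set0.
Proof.
move=> a_le_t [tt' _ _ [s sb [t's hs]]] [tt'' _ h _] t'b ub.
have [||v sv Bv] := curve_stays_in_ball _ _ t's t'b; [lra|lra|].
have vt'' : v <= t'' by apply: h => //; lra.
apply/eqP/negPn/negP => /set0P tu; have := hs u _ tu; lra.
Qed.

Lemma greedy_terminates (T : nat -> R) :
  T 0%N = a -> (forall n, greedy_step (T n) (T n.+1)) ->
  exists n, mdist (g (T n)) (g b) <= r (g (T n)).
Proof.
move=> T0 Tstep; apply: contrapT => /forallNP nstop.
have T_nd : {homo T : m n / (m <= n)%N >-> m <= n}.
  apply: homo_leq => // [x y z|n]; first exact: le_trans.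
  by have [/andP[]] := Tstep n.
have Ta n : a <= T n by rewrite -T0; exact: T_nd.
have Tb n : T n <= b by have [/andP[]] := Tstep n => *; lra.
have hT : has_sup (range T).
  by split; [exists (T 0%N); exists 0%N | exists b => _ [n _ <-]].
have leT n : T n <= sup (range T).
  by apply: ub_le_sup; [case: hT | exists n].
have supb : sup (range T) <= b.
  by apply: ge_sup; [case: hT | move=> _ [n _ <-]].
have Lab : a <= sup (range T) <= b by have := Ta 0%N; have := leT 0%N; lra.
set L := sup (range T) in leT Lab.
(* With a quarter, two late points are less than [r (g L) / 2] apart while their radii exceed three
   quarters of [r (g L)]. *)
have [|d d0 dP] := @curve_mdist_lt _ _ _ _ _ L (r (g L) / 4) g_curve Lab.
  have := r_gt0 Lab; lra.
have [_ [n _ <-] dn] := sup_adherent d0 hT.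
have near m : (n <= m)%N -> mdist (g L) (g (T m)) < r (g L) / 4.
  move=> nm; apply: dP; first by rewrite Ta Tb.
  have := T_nd _ _ nm; have := leT m; rewrite -/L in dn.
  by move=> *; rewrite ler0_norm; lra.
have far : r (g (T n)) <= mdist (g (T n)) (g (T n.+1)).
  apply: (greedy_step_far (Ta n) (Tstep n)).
  by rewrite ltNge; apply/negP/nstop.
have := near _ (leqnn n); have := near _ (leqnSn n).
have := metric_triangle (g (T n)) (g L) (g (T n.+1)).
rewrite (metric_sym (g (T n)) (g L)).
have := r_lip (g L) (g (T n)); have := r_gt0 Lab; lra.
Qed.

Lemma greedy_chain : exists (k : nat) (T : nat -> R),
  [/\ T 0%N = a, (forall n, greedy_step (T n) (T n.+1)), B (T k) (g b) &
      forall n, (n < k)%N -> r (g (T n)) < mdist (g (T n)) (g b)].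
Proof.
have ab : a <= b by case: g_curve.
have /choice[f fP] t : exists t', a <= t <= b -> greedy_step t t'.
  have [tab|tab] := pselect (a <= t <= b); last by exists t.
  by have [t' ?] := greedy_step_ex tab; exists t'.
pose T n := iter n f a.
have Tab n : a <= T n <= b.
  elim: n => [|n IH] /=; first by rewrite lexx.
  by have [+ _ _ _] := fP _ IH; rewrite -/(T n); lra.
have Tstep n : greedy_step (T n) (T n.+1) by exact: fP.
have [n nP] := @greedy_terminates T erefl Tstep.
have ex : exists n, mdist (g (T n)) (g b) <= r (g (T n)) by exists n.
(* Minimality of [k] keeps the endpoint outside all earlier balls. *)
have [k kP kmin] := ex_minnP ex.
exists k, T; split => // m mk; rewrite ltNge; apply/negP => /kmin; lia.
Qed.

End BallChain.

(* [t i] is the parameter of the point [z i] on the curve; the indices that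
   matter are 1, ..., k+1 for [t] and [z], and 1, ..., k for [r]. *)
Theorem lemma3p2 (R : realType) (X : metricType R) (G : set X)
    (G_proper : G `<` [set: X]) (G_domain : domain G)
    (mu : R) (mu01 : 0 < mu < 1) (x y : X) (Gx : G x) (Gy : G y)
    (xy_far : mu * Num.max (bdist G x) (bdist G y) < mdist x y)
    (a b : R) (g : R -> X) (g_curve : curve a b g)
    (g_rect : rectifiable a b g) (g_in_G : g @` `[a, b] `<=` G)
    (ga : g a = x) (gb : g b = y) :
  exists (k : nat) (t : nat -> R) (z : nat -> X) (r : nat -> R),
    [/\ (1 <= k)%N,
        [/\ t 1%N = a, t k.+1 = b, z 1%N = x & z k.+1 = y],
        (forall i : nat, (1 <= i <= k.+1)%N -> a <= t i <= b /\ z i = g (t i)) &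
        (forall i : nat, (1 <= i <= k)%N -> cball (z i) (r i) `<=` G)] /\
    [/\ (forall i : nat, (1 <= i <= k)%N -> r i = mu * bdist G (z i)) /\
        (forall i : nat, (2 <= i <= k)%N ->
           t i.-1 <= t i <= b /\ ~ ball (z i.-1) (r i.-1) (z i)),
        cball (z k) (r k) (z k.+1),
        ((3 <= k)%N -> forall i j : nat,
           (1 <= i <= k)%N -> (1 <= j <= k)%N -> (1 < `|j - i|)%N ->
           cball (z i) (r i) `&` cball (z j) (r j) = set0) &
        (forall i : nat, (1 <= i <= k.-1)%N ->
           cball (z i) (r i) `&` cball (z i.+1) (r i.+1) !=set0)].
Proof.
have [mu0 mu1] := andP mu01; have [_ oG _] := G_domain.
pose r z := mu * bdist G z.
have gG s : a <= s <= b -> G (g s).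
  by move=> sab; apply: g_in_G; exists s => //=; rewrite in_itv.
have r_gt0 s : a <= s <= b -> 0 < r (g s).
  by move=> /gG Gs; rewrite mulr_gt0// bdist_gt0.
have r_lip z w : r z <= r w + mdist z w.
  (* Here [mu < 1] turns the Lipschitz constant [mu] into 1. *)
  rewrite /r; have := bdist_lipschitz z w G_proper; have := mdist_ge0 z w; nra.
have [k [T [T0 Tstep Tk Tmin]]] := greedy_chain g_curve r_lip r_gt0.
have T_nd : {homo T : m n / (m <= n)%N >-> m <= n}.
  apply: homo_leq => // [u v w|n]; first exact: le_trans.
  by have [/andP[]] := Tstep n.
have Tab n : a <= T n <= b.
  have := T_nd _ _ (leq0n n); rewrite T0.
  by have [/andP[]] := Tstep n => *; lra.
(* The centres [T 0], ..., [T k] get the indices 1, ..., [k.+1], so there are [k.+1] balls; the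
   endpoint takes index [k.+2]. *)
pose t i := if i == k.+2 then b else T i.-1.
have tE i : (i <= k.+1)%N -> t i = T i.-1.
  by rewrite /t; case: eqP => // ->; lia.
have tb : t k.+2 = b by rewrite /t eqxx.
exists k.+1, t, (g \o t), (r \o g \o t); split; split => //.
- by split=> //=; rewrite ?tb// tE// T0.
- move=> i _; split=> //; rewrite /t; case: ifP => // _.
  by have := Tab 0%N; lra.
- move=> i /andP[_ ik]; apply: cball_bdist_sub => //=.
  by apply: gG; rewrite tE.
- split=> // -[//|[//|i]] /andP[_ ik]; rewrite /= !tE /=; try lia.
  split; first by have := Tab i.+1; have := T_nd _ _ (leqnSn i); lra.
  rewrite ballEmdist /=; apply/negP; rewrite -leNgt.
  have /andP[Ta _] := Tab i.
  by apply: (greedy_step_far g_curve Ta (Tstep i)); apply: Tmin; lia.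
- by rewrite /= tb tE.
- have disj i j : (1 <= i)%N -> (i.+1 < j <= k.+1)%N ->
      cball (g (t i)) (r (g (t i))) `&` cball (g (t j)) (r (g (t j))) = set0.
    case: i => // i _ /andP[ij jk]; rewrite !tE /=; try lia.
    have /andP[Ta _] := Tab i; have /andP[_ Tb] := Tab j.-1.
    (* After the shift [i.+2 <= j.-1 <= k], so the ball at [T i.+1] still misses the endpoint. *)
    apply: (greedy_step2_disjoint g_curve Ta (Tstep i) (Tstep i.+1)).
      by apply: Tmin; lia.
    by rewrite Tb andbT; apply: T_nd; lia.
  move=> _ i j ik jk ij.
  have [h|h] := ltnP i j; first by apply: disj; lia.
  by rewrite setIC; apply: disj; lia.
- move=> [//|i] /andP[_ ik]; rewrite /= !tE /=; try lia.
  by have [_ + _ _] := Tstep i.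
Qed.
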